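(* Let $\ell\ge1$, $n\ge 1$, let $\lambda$ be a primitive linear character of $R^+$, and let $X$ be the module afforded by a Weil representation of $\mathrm{Sp}=\mathrm{Sp}(V,f)$ of type $\lambda$. Then $X$ has exactly $2\ell$ irreducible constituents as an $\mathrm{Sp}$-module, all non-isomorphic to each other. Their dimensions are as follows: for each $i$ with $1\le i<\ell$ there are two constituents of dimension $$ \frac{q^{[2(\ell-i)-1]n}(q^{2n}-1)}{2}, $$ and the remaining two constituents have dimensions $\frac{q^n+1}{2}$ and $\frac{q^n-1}{2}$.
   Context: Rings. Let $\mathcal{O}$ be a local principal ideal domain that is not a field, with maximal ideal $\mathcal{O}s$ and finite residue field $F_q$ of odd characteristic. Let $\mathcal{R}=\mathcal{O}[X]/(X^2-s)=\mathcal{O}\oplus\mathcal{O}t$, $t^2=s$, with the involution fixing $\mathcal{O}$ elementwise and sending $t\mapsto -t$. Fix $\ell\ge 1$ and set $A=\mathcal{R}/\mathcal{R}t^{2\ell-1}$, $R=\mathcal{O}/\mathcal{O}s^{\ell}$. Let $\pi$ be the image of $t$ in $A$ and $p$ the image of $s$ in $R$. Then $R$ embeds in $A$, $A=R\oplus R\pi$, $\pi^2=p$, and $A$ has an induced involution $*$ fixing $R$ elementwise and sending $\pi\mapsto-\pi$. Forms. $V$ is a free $A$-module of rank $2n$, $n\ge 1$ (not a free $R$-module when $\ell>1$), and $h:V\times V\to A$ is a nondegenerate skew hermitian form: $h$ is $A$-linear in the second variable, $*$-linear in the first, $h(v,u)=-h(u,v)^*$, and $u\mapsto h(u,-)$ is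 an injective map $V\to\mathrm{Hom}_A(V,A)$. Put $f(v,w)=\frac{h(v,w)+h(v,w)^*}{2}\in R$; this is a nondegenerate alternating $R$-bilinear form on $V$. $\mathrm{Sp}=\mathrm{Sp}(V,f)$ is the group of all $g\in\mathrm{GL}_R(V)$ preserving $f$. Weil representations. A linear character $\lambda:R^+\to\mathbb{C}^\times$ is primitive if its kernel contains no nonzero ideal of $R$. The Heisenberg group is $H=R\times V$ with $(r,u)(s,v)=(r+s+f(u,v),u+v)$ and center $(R,0)$, identified with $R^+$. Up to isomorphism $H$ has a unique irreducible complex representation $S:H\to\mathrm{GL}(X)$ on which $(R,0)$ acts via $\lambda$ (Schrödinger representation of type $\lambda$); its dimension is $\sqrt{|V|}$. A Weil representation of $\mathrm{Sp}$ of type $\lambda$ is any representation $W:\mathrm{Sp}\to\mathrm{GL}(X)$ with $W(g)S(r,u)W(g)^{-1}=S(r,gu)$ for all $g\in \mathrm{Sp}$, $(r,u)\in H$. (Such representations exist, and any two differ by a linear character of $\mathrm{Sp}$.) All representations are finite dimensional over $\mathbb{C}$. *)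

(* Defs.v *)
From HB Require Import structures.
From mathcomp Require Import all_boot all_order all_algebra.
From mathcomp Require Import all_fingroup all_solvable all_field all_character.
From mathcomp Require Import complex reals ring.

Set Implicit Arguments.
Unset Strict Implicit.
Unset Printing Implicit Defensive.

Import Order.TTheory GRing.Theory Num.Theory.
Local Open Scope ring_scope.

Section Ideals.
Variable R : comNzRingType.
Implicit Types I J : R -> Prop.

Definition is_ideal I : Prop :=
  [/\ I 0, forall x y, I x -> I y -> I (x + y) & forall a x, I x -> I (a * x)].

Definition principal (x : R) : R -> Prop := fun y => exists a, y = a * x.

Definition maximal_ideal I : Prop :=
  [/\ is_ideal I, ~ I 1
    & forall J, is_ideal J -> (forall x, I x -> J x) ->
      (forall x, J x <-> I x) \/ (forall x, J x)].

Definition principal_ideal_ring : Prop :=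
  forall I, is_ideal I -> exists x, forall y, I y <-> principal x y.

Definition local_with_maximal_ideal I : Prop :=
  maximal_ideal I /\ forall J, maximal_ideal J -> forall x, J x <-> I x.

(* [phi] exhibits its codomain as the quotient ring R / I. *)
Definition is_quotient (Q : nzRingType) (phi : {rmorphism R -> Q}) I : Prop :=
  (forall y, exists x, phi x = y) /\ (forall x, phi x = 0 <-> I x).

End Ideals.

Definition is_field (R : unitRingType) : Prop :=
  forall x : R, x != 0 -> x \is a GRing.unit.

(* O[X]/(X^2 - s): the modulus is monic of size 3, so the quotient is really
   by it. [ramC] is the embedding of O and [ramt] the class t of 'X. *)
Notation ramified s := {poly %/ 'X^2 - s%:P}.

Definition ramC (O : comNzRingType) (s c : O) : ramified s :=
  in_qpoly ('X^2 - s%:P) c%:P.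

Definition ramt (O : comNzRingType) (s : O) : ramified s :=
  in_qpoly ('X^2 - s%:P) 'X.

(* V as an R-module, R acting through iota : R -> A. *)
Definition restr (R A : nzRingType) (iota : {rmorphism R -> A})
  (V : finLmodType A) : Type := V.

Section RestrictionOfScalars.
Variables (R A : nzRingType) (iota : {rmorphism R -> A}) (V : finLmodType A).
Local Notation VR := (restr iota V).

HB.instance Definition _ := Finite.on VR.
HB.instance Definition _ := GRing.Zmodule.on VR.

Definition restr_scale (r : R) (v : VR) : VR := iota r *: (v : V).

Fact restr_scaleA a b v :
  restr_scale a (restr_scale b v) = restr_scale (a * b) v.
Proof. by rewrite /restr_scale scalerA rmorphM. Qed.
Fact restr_scale1 : left_id 1 restr_scale.
Proof. by move=> v; rewrite /restr_scale rmorph1 scale1r. Qed.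
Fact restr_scaleDr : right_distributive restr_scale +%R.
Proof. by move=> a u v; rewrite /restr_scale scalerDr. Qed.
Fact restr_scaleDl v : {morph restr_scale^~ v : a b / a + b}.
Proof. by move=> a b; rewrite /restr_scale rmorphD scalerDl. Qed.

HB.instance Definition _ := GRing.Zmodule_isLmodule.Build R VR
  restr_scaleA restr_scale1 restr_scaleDr restr_scaleDl.

End RestrictionOfScalars.

Definition free_of_rank (A : nzRingType) (V : lmodType A) (m : nat) : Prop :=
  exists b : 'I_m -> V,
    forall v, exists! c : 'rV[A]_m, v = \sum_(i < m) c 0 i *: b i.

Definition nondegenerate_skew_hermitian (A : comNzRingType)
    (star : A -> A) (V : lmodType A) (h : V -> V -> A) : Prop :=
  [/\ forall v u w, h v (u + w) = h v u + h v w,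
      forall a v u, h v (a *: u) = a * h v u,
      (forall v w u, h (v + w) u = h v u + h w u) /\
        (forall a v u, h (a *: v) u = star a * h v u),
      forall v u, h v u = - star (h u v)
    & forall u u', (forall v, h u v = h u' v) -> u = u'].

(* [f] is an index here, so that the group law may depend on it. *)
Definition heisenberg (R : finComNzRingType) (M : finLmodType R)
  (f : {biscalar M}) : Type := (R * M)%type.

Section Groups.
Variables (R : finComNzRingType) (M : finLmodType R) (f : {biscalar M}).
Local Notation heisenberg := (heisenberg f).

HB.instance Definition _ := Finite.on heisenberg.

Definition heis (r : R) (u : M) : heisenberg := (r, u).

Definition heis_mul (x y : heisenberg) : heisenberg :=
  heis (x.1 + y.1 + f x.2 y.2) (x.2 + y.2).
Definition heis_one : heisenberg := heis 0 0.
Definition heis_inv (x : heisenberg) : heisenberg :=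
  heis (- x.1 + f x.2 x.2) (- x.2).

Fact heis_mulA : associative heis_mul.
Proof.
case=> [r u] [s v] [t w]; rewrite /heis_mul /heis /= addrA.
by rewrite linearDr linearDl /= !addrA; congr (_, _); ring.
Qed.
Fact heis_mul1 : left_id heis_one heis_mul.
Proof.
by case=> [r u]; rewrite /heis_mul /heis /= !add0r linear0l addr0.
Qed.
Fact heis_mulV : left_inverse heis_one heis_inv heis_mul.
Proof.
case=> [r u]; rewrite /heis_mul /heis_one /heis /= addNr linearNl.
by congr (_, _); ring.
Qed.

HB.instance Definition _ := Finite_isGroup.Build heisenberg
  heis_mulA heis_mul1 heis_mulV.

Definition symplectic (g : {perm M}) : bool :=
  [&& [forall u, forall v, g (u + v) == g u + g v],
      [forall a : R, forall u, g (a *: u) == a *: g u]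
    & [forall u, forall v, f (g u) (g v) == f u v]].

(* Sp(M, f), with the product g h = g \o h; the product of {perm M} composes
   in the opposite order. *)
Definition Sp : Type := {g : {perm M} | symplectic g}.
HB.instance Definition _ := Finite.on Sp.


Fact symplectic1 : symplectic 1%g.
Proof.
by apply/and3P; split; apply/forallP=> u; apply/forallP=> v; rewrite !perm1.
Qed.

Fact symplecticM g h : symplectic g -> symplectic h -> symplectic (g * h)%g.
Proof.
case/and3P=> /forallP gD /forallP gZ /forallP gf.
case/and3P=> /forallP hD /forallP hZ /forallP hf.
apply/and3P; split; apply/forallP=> u; apply/forallP=> v; rewrite !permM.
- by rewrite (eqP (forallP (gD u) v)) (eqP (forallP (hD _) _)).
- by rewrite (eqP (forallP (gZ u) v)) (eqP (forallP (hZ _) _)).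
- by rewrite (eqP (forallP (hf _) _)) (eqP (forallP (gf _) _)).
Qed.

Fact symplecticV g : symplectic g -> symplectic g^-1%g.
Proof.
case/and3P=> /forallP gD /forallP gZ /forallP gf.
apply/and3P; split; apply/forallP=> u; apply/forallP=> v.
- by rewrite -(inj_eq (@perm_inj _ g)) (eqP (forallP (gD _) _)) !permKV.
- by rewrite -(inj_eq (@perm_inj _ g)) (eqP (forallP (gZ _) _)) !permKV.
- by rewrite -(eqP (forallP (gf _) _)) !permKV.
Qed.

Definition Sp_mul (g h : Sp) : Sp :=
  exist _ (val h * val g)%g (symplecticM (valP h) (valP g)).
Definition Sp_one : Sp := exist _ 1%g symplectic1.
Definition Sp_inv (g : Sp) : Sp :=
  exist _ (val g)^-1%g (symplecticV (valP g)).

Fact Sp_mulA : associative Sp_mul.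
Proof. by move=> g h k; apply: val_inj; rewrite /= mulgA. Qed.
Fact Sp_mul1 : left_id Sp_one Sp_mul.
Proof. by move=> g; apply: val_inj; rewrite /= mulg1. Qed.
Fact Sp_mulV : left_inverse Sp_one Sp_inv Sp_mul.
Proof. by move=> g; apply: val_inj; rewrite /= mulgV. Qed.

HB.instance Definition _ := Finite_isGroup.Build Sp Sp_mulA Sp_mul1 Sp_mulV.

Definition Sp_perm (g : Sp) : {perm M} := val g.

End Groups.

Coercion Sp_perm : Sp >-> perm_of.

Section Representations.
Variables (R : finComNzRingType) (C : fieldType).

Definition linear_character (lam : R -> C) : Prop :=
  lam 0 = 1 /\ forall x y, lam (x + y) = lam x * lam y.

Definition primitive_character (lam : R -> C) : Prop :=
  forall I, is_ideal I -> (forall x, I x -> lam x = 1) ->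
    forall x, I x -> x = 0.

Variables (M : finLmodType R) (f : {biscalar M}) (d : nat).

(* S and W are homomorphisms into GL_d(C), the matrices being those of the
   operators on column vectors. The modules of mxrepresentation are the
   row spaces stable under right multiplication by the W g; on a direct sum of
   simple ones W is block diagonal, and its diagonal blocks are the irreducible
   constituents in either convention. *)

Definition schrodinger (lam : R -> C)
    (S : mx_representation C [set: heisenberg f] d) : Prop :=
  mx_irreducible S /\ forall r, S (heis f r 0) = (lam r)%:M.

Definition weil (S : mx_representation C [set: heisenberg f] d)
    (W : mx_representation C [set: Sp f] d) : Prop :=
  forall (g : Sp f) (r : R) (u : M),
    W g *m S (heis f r u) *m invmx (W g) = S (heis f r (g u)).

End Representations.

(* Main.v *)
Require Import Defs.
From mathcomp Require Import all_boot all_order all_algebra.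
From mathcomp Require Import all_fingroup all_solvable all_field all_character.
From mathcomp Require Import complex reals ring zify.

Set Implicit Arguments.
Unset Strict Implicit.
Unset Printing Implicit Defensive.

Import Order.TTheory GRing.Theory Num.Theory.
Local Open Scope ring_scope.
Local Open Scope complex_scope.

(** The operators [T v = S (0, v)], [v] in [V], form a basis of the full matrix
    algebra and [W] permutes them, so the commutant of [W] has a basis indexed
    by the orbits of [Sp] on [V].  Symplectic transvections show that these
    orbits are the [2l] layers of the filtration [U j = pi^j V],
    [0 <= j <= N = 2l - 1], hence the commutant is spanned by the sums [F j] of
    [T v] over [v] in [U j].  As the orthogonal of [U j] is [U (N - j)], for
    [i <= j] one finds [F i * F j = F j * F i = #|U j| F (max i (N - j))].
    So [g = F 0 / q^(nN)] is an involution, the [c i = F (N - i) / #|U (N - i)|]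
    with [i < l] form a decreasing chain of idempotents, and the commutant is
    spanned by the [2l] orthogonal idempotents [(c i - c (i+1)) (1 +- g) / 2]
    (with [c l = 0]).  Their images are the constituents, and their ranks are
    traces, read off from [tr T v = 0] for [v <> 0]. *)

(** * Representations with a prescribed commutant *)

(** Idempotence makes the reversed product [row_base E *m col_base E] of the rank factorization an
    identity matrix of size [\rank E]. *)
Lemma mxtrace_idempotent (F : fieldType) (d : nat) (E : 'M[F]_d) :
  E *m E = E -> \tr E = (\rank E)%:R.
Proof.
move=> EE; rewrite -{1}(mulmx_base E) mxtrace_mulC.
suff -> : row_base E *m col_base E = 1%:M by rewrite mxtrace1.
apply: (row_free_inj (row_base_free E)).
apply/(row_full_inj (col_base_full E)).
rewrite mul1mx mulmx_base 2!(mulmxA (col_base E)) mulmx_base.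
by rewrite -(mulmxA E) mulmx_base EE.
Qed.

Section CommutantDecomposition.
Variables (F : fieldType) (gT : finGroupType) (G : {group gT}) (d : nat).
Variables (rG : mx_representation F G d) (I : finType) (E : I -> 'M[F]_d).

Definition in_commutant (M : 'M[F]_d) : Prop :=
  forall x, x \in G -> M *m rG x = rG x *m M.

Hypothesis charG : ([pchar F]^'.-group G)%g.
Hypothesis orthoE : forall i j, E i *m E j = if i == j then E i else 0.
Hypothesis sumE : \sum_i E i = 1%:M.
Hypothesis nzE : forall i, E i != 0.
Hypothesis comE : forall i, in_commutant (E i).
Hypothesis scalarE :
  forall M, in_commutant M -> forall i, exists c, M *m E i = c *: E i.

Let idemE i : E i *m E i = E i.
Proof. by rewrite orthoE eqxx. Qed.

Let sub_idem m (U : 'M_(m, d)) i : (U <= E i)%MS -> U *m E i = U.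
Proof. by case/submxP=> D ->; rewrite -mulmxA idemE. Qed.

Lemma commutant_mxmodule M : in_commutant M -> mxmodule rG M.
Proof. by move=> comM; apply/mxmoduleP=> x Gx; rewrite comM ?submxMl. Qed.

(** By Maschke a submodule [U] of [E i] is the image of a projection [P] in the commutant. Then
    [P = P *m E i] is a nonzero multiple of [E i], so [U] is all of [E i]. *)
Lemma commutant_mxsimple i : mxsimple rG (E i).
Proof.
split=> // [|U modU sUE nzU]; first exact/commutant_mxmodule.
have [U' modU' defUU' dxUU'] := mx_Maschke_pchar rG charG modU (submx1 U).
have tiUU' := mxdirect_addsP dxUU'.
pose P := proj_mx U U'.
have comP : in_commutant P.
  have /hom_mxP homP : (1%:M <= dom_hom_mx rG P)%MS.
    by rewrite -defUU'; apply: proj_mx_hom.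
  by move=> x Gx; rewrite -[P in LHS]mul1mx -homP // mul1mx.
have [c Pc] := scalarE comP i.
have PE : P *m E i = P.
  by rewrite sub_idem // (submx_trans _ sUE) // -[P]mul1mx proj_mx_sub.
have UP : U *m P = U by rewrite proj_mx_id.
have nzc : c != 0.
  by apply: contraNneq nzU => c0; rewrite -UP -PE Pc c0 scale0r mulmx0.
by rewrite -(scalerK nzc (E i)) -Pc PE scalemx_sub // -[P]mul1mx proj_mx_sub.
Qed.

(** An isomorphism [f] would put [E i *m f] in the commutant with image in [E j], making it a
    multiple of [E j]; left multiplication by [E i] then kills it. *)
Lemma commutant_non_iso i j : i != j -> ~ mx_iso rG (E i) (E j).
Proof.
move=> neq_ij [f f_unit /hom_mxP homf defE].
have comEf : in_commutant (E i *m f).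
  by move=> x Gx; rewrite -homf // comE // mulmxA.
have [c Ec] := scalarE comEf j.
have EfE : E i *m f *m E j = E i *m f by rewrite sub_idem // defE.
have := congr1 (mulmx (E i)) Ec.
rewrite EfE mulmxA idemE -scalemxAr orthoE (negPf neq_ij) scaler0 => Ef0.
by have := nzE j; rewrite -(eqmx_eq0 defE) Ef0 eqxx.
Qed.

Lemma commutant_sum : (\sum_i E i :=: 1%:M)%MS.
Proof.
apply/eqmxP; rewrite submx1 -sumE summx_sub // => i _.
by rewrite (sumsmx_sup i).
Qed.

Lemma commutant_direct : mxdirect (\sum_i E i).
Proof.
apply/mxdirect_sumsP=> i _; apply/eqP/rowV0P=> v.
rewrite sub_capmx => /andP[/sub_idem vE /sub_sumsmxP[u defv]].
rewrite -vE defv mulmx_suml big1 // => j neq_ji.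
by rewrite -mulmxA orthoE (negPf neq_ji) mulmx0.
Qed.

End CommutantDecomposition.

(** * The operators of the Schrodinger representation *)

Lemma mxtrace_delta_mulmx (F : comPzRingType) (d : nat) (A : 'M[F]_d) i j :
  \tr (delta_mx i j *m A) = A j i.
Proof.
rewrite -(mul_delta_mx (0 : 'I_1)) -mulmxA mxtrace_mulC trace_mx11.
by rewrite -rowE -colE !mxE.
Qed.

Section SchrodingerOperators.
Variables (R : finComNzRingType) (M : finLmodType R) (f : {biscalar M}).
Variables (C : numClosedFieldType) (lam : R -> C) (d : nat).
Variable S : mx_representation C [set: heisenberg f] d.
Hypotheses (lam_char : linear_character lam)
  (lam_prim : primitive_character lam) (S_sch : schrodinger lam S).
Hypothesis fvv : forall v, f v v = 0.
Hypothesis f_nondeg : forall v, (forall u, f v u = 0) -> v = 0.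
Hypothesis two_reg : forall x : R, x + x = 0 -> x = 0.

Definition submodule_set (U : {set M}) : Prop :=
  [/\ 0 \in U, {in U &, forall u v, u + v \in U}
    & forall a, {in U, forall v, a *: v \in U}].

Lemma submodule_setN U : submodule_set U -> {in U, forall v, - v \in U}.
Proof. by case=> _ _ UZ v Uv; rewrite -scaleN1r UZ. Qed.

Lemma alternatingC u v : f u v = - f v u.
Proof.
apply/eqP; rewrite -addr_eq0; have := fvv (u + v).
by rewrite linearDl /= !linearDr /= !fvv add0r addr0 addrC => ->.
Qed.

Let lam0 : lam 0 = 1. Proof. by case: lam_char. Qed.
Let lamD x y : lam (x + y) = lam x * lam y. Proof. by case: lam_char. Qed.

(** The values [f w v] with [v] in [U] form an ideal inside the kernel of [lam], and primitivity
    forces it to vanish. *)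
Lemma character_perp (U : {set M}) w : submodule_set U ->
  {in U, forall v, lam (f w v) = 1} -> {in U, forall v, f w v = 0}.
Proof.
case=> U0 UD UZ lam1 v Uv.
apply: (lam_prim (I := fun x => exists2 v, v \in U & x = f w v)); last by exists v.
  split; first by exists 0; rewrite ?linear0r.
    by move=> _ _ [u Uu ->] [u' Uu' ->]; exists (u + u'); rewrite ?UD // linearDr.
  by move=> a _ [u Uu ->]; exists (a *: u); rewrite ?UZ // linearZr.
by move=> _ [u Uu ->]; apply: lam1.
Qed.

Definition perp (U : {set M}) : {set M} :=
  [set w | [forall v in U, f w v == 0]].

Lemma character_sum (U : {set M}) w : submodule_set U ->
  \sum_(v in U) lam (f w v) = (#|U| * (w \in perp U))%:R.
Proof.
move=> modU; rewrite inE; case: (boolP [forall v in U, _]) => [/forall_inP pw | ].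
  rewrite muln1 -sum1_card natr_sum; apply: eq_bigr => v Uv.
  by rewrite (eqP (pw v Uv)) lam0.
rewrite negb_forall_in muln0 => /exists_inP[v0 Uv0 nz].
have /existsP[v1 /andP[Uv1 nz1]] : [exists v, (v \in U) && (lam (f w v) != 1)].
  apply: contraT; rewrite negb_exists => /forallP h.
  rewrite (character_perp modU _ Uv0) ?eqxx // in nz => v Uv.
  by have := h v; rewrite Uv /= negbK => /eqP.
have [U0 UD UZ] := modU.
set s := \sum_(v in U) _.
(* Orthogonality of characters: translation by [v1] rescales the sum by a factor other than 1. *)
have: s = lam (f w v1) * s.
  rewrite {1}/s (reindex_inj (addrI v1)) /= mulr_sumr; apply: eq_big => v.
    apply/idP/idP => [Uv|]; last exact: UD.
    by rewrite -(addKr v1 v) UD // submodule_setN.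
  by move=> _; rewrite linearDr lamD.
move/eqP; rewrite -subr_eq0 -{1}[s]mul1r -mulrBl mulf_eq0 => /orP[|/eqP//].
by rewrite subr_eq0 eq_sym (negPf nz1).
Qed.

Definition schrop (v : M) : 'M[C]_d := S (heis f 0 v).
Local Notation T := schrop.

Let repS (x y : heisenberg f) : S (x * y)%g = S x *m S y.
Proof. by rewrite repr_mxM ?inE. Qed.

Lemma schrop_heis r v : S (heis f r v) = lam r *: T v.
Proof.
have -> : heis f r v = (heis f r 0 * heis f 0 v)%g.
  by congr (_, _) => /=; rewrite ?linear0l ?add0r ?addr0.
by rewrite repS; case: S_sch => _ ->; rewrite mul_scalar_mx.
Qed.

Lemma schrop0 : T 0 = 1%:M.
Proof. by rewrite /T; case: S_sch => _ ->; rewrite lam0. Qed.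

Lemma schropM u v : T u *m T v = lam (f u v) *: T (u + v).
Proof.
rewrite -repS -schrop_heis; congr (S _).
by congr (_, _) => /=; rewrite ?add0r.
Qed.

(** Conjugation by [T u] multiplies [T v] by [lam (f u v + f u v)]. For [v != 0] some [u] makes this
    factor differ from 1, by nondegeneracy and regularity of 2. *)
Lemma schrop_trace v : \tr (T v) = (d * (v == 0))%:R.
Proof.
have [->|nzv] := eqVneq v 0; first by rewrite schrop0 mxtrace1 muln1.
rewrite muln0.
have /existsP[u nz] : [exists u, lam (f u v + f u v) != 1].
  apply: contraT; rewrite negb_exists => /forallP h.
  rewrite (f_nondeg (v := v)) ?eqxx // in nzv => u; apply: two_reg.
  rewrite -linearDl.
  have modT : submodule_set setT by split=> [|u1 v1 _ _|a u1 _]; rewrite inE.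
  apply: (character_perp modT _ (in_setT u)) => x _.
  have := h (- x); rewrite negbK => /eqP <-; congr lam.
  by rewrite alternatingC linearDr opprD linearNl.
have e : T u *m T v *m T (- u) = lam (f u v + f u v) *: T v.
  rewrite schropM -scalemxAl schropM scalerA -lamD; congr (lam _ *: T _).
    by rewrite linearDl linearNr fvv oppr0 add0r linearNr -alternatingC.
  by rewrite addrAC subrr add0r.
have := congr1 mxtrace e.
rewrite mxtrace_mulC mulmxA schropM addNr schrop0 linearNl fvv oppr0 lam0.
rewrite scale1r mul1mx linearZ /= => /eqP.
rewrite -subr_eq0 -{1}[\tr _]mul1r -mulrBl mulf_eq0 => /orP[|/eqP//].
by rewrite subr_eq0 eq_sym (negPf nz).
Qed.

(** Irreducibility over a closed field makes the [S x] span all matrices, so [A] may be taken to be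
    some [S (r, u)]; then only the term [v = u] has nonzero trace. *)
Lemma schrop_expansion A :
  d%:R *: A = \sum_v \tr (A *m T (- v)) *: T v.
Proof.
have [/group_closure_closed_field/andP[_ fullS] _] := S_sch.
have /envelop_mxP[a ->] : (A \in enveloping_algebra_mx S)%MS by rewrite submx_full.
rewrite scaler_sumr.
under [RHS]eq_bigr => v _ do rewrite mulmx_suml raddf_sum /= scaler_suml.
rewrite exchange_big /=; apply: eq_bigr => -[r u] _.
have -> : S (r, u) = lam r *: T u by rewrite -schrop_heis.
rewrite (bigD1 u) //= big1 => [|v neq_vu].
  rewrite addr0 -!scalemxAl schropM linearNr fvv oppr0 lam0 scale1r.
  rewrite subrr schrop0 !mxtraceZ mxtrace1 !scalerA; congr (_ *: _).
  by ring.
rewrite -!scalemxAl schropM !mxtraceZ schrop_trace subr_eq0 eq_sym.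
by rewrite (negPf neq_vu) muln0 !mulr0 scale0r.
Qed.

Lemma schrodinger_dim : (d ^ 2 = #|M|)%N.
Proof.
have [/group_closure_closed_field/andP[d_gt0 _] _] := S_sch.
apply/eqP; rewrite -(eqr_nat C) natrX.
have nzd : (d%:R : C) != 0 by rewrite pnatr_eq0 -lt0n.
rewrite -(inj_eq (mulfI nzd)).
(* The expansion is applied to every matrix unit and its [(i, j)] entry taken. Summing over [i] and
   [j] turns the other side into the traces of [T v *m T (- v) = 1], one for each [v]. *)
have -> : d%:R * d%:R ^+ 2 =
    \sum_(i < d) \sum_(j < d) (d%:R *: delta_mx i j : 'M[C]_d) i j.
  under eq_bigr => i _ do under eq_bigr => j _ do
    rewrite !mxE !eqxx mulr1.
  by rewrite !sumr_const !card_ord expr2 mulrA !mulr_natr.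
have entry i j : (d%:R *: delta_mx i j : 'M[C]_d) i j =
    \sum_v T v i j * T (- v) j i.
  rewrite (schrop_expansion (delta_mx i j)).
  rewrite summxE.
  apply: eq_bigr => v _.
  rewrite mxtrace_delta_mulmx.
  by rewrite mxE mulrC.
under eq_bigr => i _ do under eq_bigr => j _ do rewrite entry.
under eq_bigr => i _ do rewrite exchange_big.
rewrite exchange_big /= (eq_bigr (fun=> d%:R)) => [|v _].
  by rewrite sumr_const -[d%:R *+ _]mulr_natr; apply/eqP.
transitivity (\tr (T v *m T (- v))).
  by apply: eq_bigr => i _; rewrite mxE.
by rewrite schropM linearNr fvv oppr0 lam0 scale1r subrr schrop0 mxtrace1.
Qed.

End SchrodingerOperators.

(** * Weil representations and an orbit filtration *)

Section FilteredWeil.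
Variables (R : finComNzRingType) (M : finLmodType R) (f : {biscalar M}).
Variables (C : numClosedFieldType) (lam : R -> C) (d : nat).
Variable S : mx_representation C [set: heisenberg f] d.
Variable W : mx_representation C [set: Sp f] d.
Hypotheses (lam_char : linear_character lam)
  (lam_prim : primitive_character lam) (S_sch : schrodinger lam S)
  (W_weil : weil S W).
Hypothesis fvv : forall v, f v v = 0.
Hypothesis f_nondeg : forall v, (forall u, f v u = 0) -> v = 0.
Hypothesis two_reg : forall x : R, x + x = 0 -> x = 0.

Variables (l r : nat) (U : nat -> {set M}).
Local Notation N := (2 * l - 1)%N.
Hypotheses (l_gt0 : (0 < l)%N) (r_gt1 : (1 < r)%N).
Hypothesis U_submodule : forall j, submodule_set (U j).
Hypothesis U_first : U 0 = setT.
Hypothesis U_decr : forall i j, (i <= j)%N -> U j \subset U i.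
Hypothesis U_perp : forall j, (j <= N)%N -> perp f (U j) = U (N - j).
Hypothesis U_card : forall j, (j <= N)%N -> #|U j| = (r ^ (2 * (N - j)))%N.
Hypothesis U_trans : forall j v w, v \in U j :\: U j.+1 -> w \in U j :\: U j.+1 ->
  (j < N)%N -> exists g : Sp f, g v = w.

Local Notation T := (schrop S).

Definition level_sum j : 'M[C]_d := \sum_(v in U j) T v.
Local Notation F := level_sum.

Let lam0 : lam 0 = 1. Proof. by case: lam_char. Qed.

Let UN j v : (- v \in U j) = (v \in U j).
Proof.
apply/idP/idP=> Uv; last exact: submodule_setN.
by rewrite -[v]opprK submodule_setN.
Qed.

Let UDl j u v : u \in U j -> (v + u \in U j) = (v \in U j).
Proof.
have [_ UD _] := U_submodule j.
move=> Uu; apply/idP/idP=> Uv; last exact: UD.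
by rewrite -(addrK u v) UD // UN.
Qed.

Let UI i j : U i :&: U j = U (maxn i j).
Proof.
have [le_ij|/ltnW le_ji] := leqP i j; first exact/setIidPr/U_decr.
exact/setIidPl/U_decr.
Qed.

Let level_sum_perp i j : (j <= N)%N ->
  \sum_(u in U i) (#|U j| * (u \in U (N - j)))%:R *: T u =
    #|U j|%:R *: F (maxn i (N - j)).
Proof.
move=> le_jN; rewrite /F -UI scaler_sumr.
under [RHS]eq_bigl => u do rewrite inE.
rewrite big_mkcondr /=; apply: eq_bigr => u _.
by case: ifP; rewrite ?muln1 ?muln0 ?scale0r.
Qed.

(** Since [U j] lies in [U i], replacing [u] by [u - v] turns the product into a sum of
    [lam (f u v) *: T u]. The character sum over [v] in [U j] retains only the [u] in
    [perp f (U j) = U (N - j)]. *)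
Lemma level_sumM i j : (i <= j)%N -> (j <= N)%N ->
  F i *m F j = #|U j|%:R *: F (maxn i (N - j)) /\
  F j *m F i = #|U j|%:R *: F (maxn i (N - j)).
Proof.
move=> le_ij le_jN; rewrite -level_sum_perp //.
have Uji v : v \in U j -> - v \in U i.
  by rewrite UN; apply/subsetP/U_decr.
rewrite !mulmx_suml; split.
  under eq_bigr => u _ do rewrite mulmx_sumr.
  rewrite exchange_big /=.
  under eq_bigr => v Uv.
    rewrite (reindex_inj (addIr (- v))) /=.
    under eq_bigl => u do rewrite (UDl _ (Uji _ Uv)).
    under eq_bigr => u _ do rewrite (schropM S_sch) linearBl /= fvv subr0 subrK.
    over.
  rewrite exchange_big /=; apply: eq_bigr => u _.
  by rewrite -scaler_suml (character_sum f lam_char lam_prim) // U_perp.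
under eq_bigr => v Uv.
  rewrite mulmx_sumr (reindex_inj (addIr (- v))) /=.
  under eq_bigl => u do rewrite (UDl _ (Uji _ Uv)).
  under eq_bigr => u _.
    rewrite (schropM S_sch) linearBr /= fvv subr0 (alternatingC fvv).
    rewrite -linearNl addrCA subrr addr0.
    over.
  over.
rewrite exchange_big /=; apply: eq_bigr => u _.
by rewrite -scaler_suml (character_sum f lam_char lam_prim) // U_perp // UN.
Qed.

Lemma level_sum_trace j : \tr (F j) = d%:R.
Proof.
have [U0 _ _] := U_submodule j.
rewrite raddf_sum (bigD1 0) //= big1 => [|v /andP[_ /negPf nzv]].
  by rewrite (schrop_trace lam_char lam_prim) // eqxx muln1 addr0.
by rewrite (schrop_trace lam_char lam_prim) // nzv muln0.
Qed.

Lemma U_last : U N = [set 0].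
Proof.
apply/eqP; rewrite eq_sym eqEcard cards1 U_card // subnn muln0 expn0 leqnn andbT.
by rewrite sub1set; have [] := U_submodule N.
Qed.

Lemma level_sum_last : F N = 1%:M.
Proof. by rewrite /F U_last big_set1 (schrop0 lam_char). Qed.

Lemma weil_dim : d = (r ^ N)%N.
Proof.
apply/eqP; rewrite -(eqn_exp2r _ _ (isT : 0 < 2)%N) -expnM mulnC.
rewrite (schrodinger_dim lam_char lam_prim S_sch fvv f_nondeg two_reg).
by rewrite -cardsT -U_first U_card // subn0 mulnC.
Qed.

Lemma weil_schrop (g : Sp f) v : W g *m T v = T (g v) *m W g.
Proof. by rewrite -[T (g v)]W_weil mulmxKV // repr_mx_unit ?inE. Qed.

Lemma Sp_stable (V : {set M}) : (forall g : Sp f, {in V, forall v, g v \in V}) ->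
  forall (g : Sp f) v, (g v \in V) = (v \in V).
Proof.
move=> stV g v; apply/idP/idP=> [|Vv]; last exact: stV.
move/(stV g^-1%g); congr (_ \in V).
exact: permK.
Qed.

Hypothesis U_stable : forall j (g : Sp f), {in U j, forall v, g v \in U j}.

Lemma level_sum_commutant j : in_commutant W (F j).
Proof.
move=> g _; rewrite mulmx_suml mulmx_sumr (reindex_inj (@perm_inj _ (val g))) /=.
apply: eq_big => [v|v _]; last by rewrite -weil_schrop.
exact: (Sp_stable (U_stable (j := j)) g v).
Qed.

(** Up to the factor [d], the coefficient of [T (- v)] in [A] is [\tr (A *m T v)], which is constant
    on orbits; so [A] is a combination of the [F j]. *)
Lemma commutant_scalar (A B : 'M[C]_d) : in_commutant W A ->
  (forall j, (j <= N)%N -> exists c, F j *m B = c *: B) ->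
  exists c, A *m B = c *: B.
Proof.
move=> comA FB; pose a v := \tr (A *m T v).
have a_inv (g : Sp f) v : a (g v) = a v.
  have gU : W g \in unitmx by rewrite repr_mx_unit ?inE.
  rewrite /a -[T v](mulKmx gU) weil_schrop !mulmxA [RHS]mxtrace_mulC.
  by rewrite !mulmxA -comA ?inE // mulmxK.
(* The expansion is built up from [U N], which is zero, to [U 0], which is everything, one layer
   [U j :\: U j.+1] at a time. *)
have partial k : (k <= N)%N ->
    exists c, (\sum_(v in U (N - k)) a v *: T (- v)) *m B = c *: B.
  elim: k => [|k IH] lt_kN.
    exists (a 0); rewrite subn0 U_last big_set1 oppr0 (schrop0 lam_char) //.
    by rewrite -scalemxAl mul1mx.
  have [c0 Hc0] := IH (ltnW lt_kN).
  set j := (N - k.+1)%N; have Sj : (N - k)%N = j.+1 by rewrite /j; lia.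
  have lt_jN : (j < N)%N by rewrite /j; lia.
  rewrite Sj in Hc0.
  have sU : U j.+1 \subset U j by apply: U_decr.
  have split_sum (G : M -> 'M[C]_d) : \sum_(v in U j) G v =
      \sum_(v in U j.+1) G v + \sum_(v in U j :\: U j.+1) G v.
    by rewrite (big_setID (U j.+1)) /= (setIidPr sU).
  have FN i : \sum_(v in U i) T (- v) = F i.
    rewrite /F [RHS](reindex_inj oppr_inj) /=.
    by apply: eq_bigl => v; rewrite UN.
  have [c1 Hc1] : exists c, (\sum_(v in U j :\: U j.+1) T (- v)) *m B = c *: B.
    have [c1 Hc1] := FB j (ltnW lt_jN); have [c2 Hc2] := FB j.+1 lt_jN.
    exists (c1 - c2); rewrite scalerBl -Hc1 -Hc2 -mulmxBl -2!FN (split_sum _).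
    by rewrite addrC addKr.
  have [v0 Hv0] : exists b, forall v, v \in U j :\: U j.+1 -> a v = b.
    have [->|[w Hw]] := set_0Vmem (U j :\: U j.+1).
      by exists 0 => v; rewrite inE.
    by exists (a w) => v Hv; have [g <-] := U_trans Hw Hv lt_jN; rewrite a_inv.
  exists (c0 + v0 * c1).
  rewrite split_sum mulmxDl Hc0 scalerDl; congr (_ + _).
  rewrite -scalerA -Hc1 scalemxAl; congr (_ *m _).
  by rewrite scaler_sumr; apply: eq_bigr => v /Hv0 ->.
have [c] := partial N (leqnn _); rewrite subnn U_first => Hc.
have nzd : (d%:R : C) != 0 by rewrite weil_dim pnatr_eq0 -lt0n expn_gt0 (ltnW r_gt1).
exists (d%:R^-1 * c); rewrite -scalerA -Hc -[A in LHS](scalerK nzd) -scalemxAl.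
congr (_ *: (_ *m _)).
rewrite (schrop_expansion lam_char lam_prim S_sch) // (reindex_inj oppr_inj) /=.
by apply: eq_big => [v|v _]; rewrite ?inE // opprK.
Qed.

(** For [i < l] the submodule [U (N - i)] is totally isotropic, so [T] is multiplicative on it and
    this is the averaging projector onto its fixed vectors. The default 0 makes the last difference
    in [weil_idem] equal to [chain_idem l.-1]. *)
Definition chain_idem i : 'M[C]_d :=
  if (i < l)%N then #|U (N - i)|%:R^-1 *: F (N - i) else 0.
(** Conjugation by this operator sends [T v] to [T (- v)]: up to a scalar it is the Weil operator of
    [-1]. *)
Definition central_involution : 'M[C]_d := (r ^ N)%:R^-1 *: F 0.
(** The boolean [true] selects the eigenvalue 1 of the involution, [false] the eigenvalue -1. *)
Definition parity_proj (b : bool) : 'M[C]_d :=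
  2^-1 *: (1%:M + (-1) ^+ (~~ b) *: central_involution).
Definition weil_idem (j : 'I_l * bool) : 'M[C]_d :=
  (chain_idem j.1 - chain_idem j.1.+1) *m parity_proj j.2.

Local Notation c := chain_idem.
Local Notation g := central_involution.
Local Notation p := parity_proj.

Let card_neq0 j : #|U j|%:R != 0 :> C.
Proof.
by rewrite pnatr_eq0 -lt0n; apply/card_gt0P; exists 0; have [] := U_submodule j.
Qed.

Let rN_neq0 : (r ^ N)%:R != 0 :> C.
Proof. by rewrite pnatr_eq0 -lt0n expn_gt0 (ltnW r_gt1). Qed.

Lemma chain_idemM i k : (i <= k)%N -> c i *m c k = c k /\ c k *m c i = c k.
Proof.
rewrite /c => le_ik; case: (ltnP k l) => [lt_kl|_]; last by rewrite mulmx0 mul0mx.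
rewrite (leq_ltn_trans le_ik lt_kl).
have [FF FF'] := @level_sumM (N - k) (N - i) ltac:(lia) ltac:(lia).
(* Isotropy enters here: [i <= k < l] gives [i <= N - k]. *)
have eqm : maxn (N - k) (N - (N - i)) = (N - k)%N by lia.
rewrite -!scalemxAl -!scalemxAr FF FF' eqm !scalerA.
by split; congr (_ *: _); field; rewrite !card_neq0.
Qed.

(** This expresses [F i] with [i < l] through [g *m c i]. For [l <= i <= N], [F i] is a multiple of
    [c (N - i)], so the [c i] and [g] account for every [F i]. *)
Lemma involution_chain i : (i < l)%N ->
  g *m c i = (r ^ N)%:R^-1 *: F i /\ c i *m g = (r ^ N)%:R^-1 *: F i.
Proof.
rewrite /c /g => lt_il; rewrite lt_il.
have [FF FF'] := @level_sumM 0 (N - i) ltac:(lia) ltac:(lia).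
have eqm : maxn 0 (N - (N - i)) = i by lia.
rewrite -!scalemxAl -!scalemxAr FF FF' eqm !scalerA.
by split; congr (_ *: _); field; rewrite rN_neq0 card_neq0.
Qed.

Lemma involution_chainC i : g *m c i = c i *m g.
Proof.
have [/involution_chain[-> ->] //|le_li] := ltnP i l.
by rewrite /c ltnNge le_li mulmx0 mul0mx.
Qed.

Lemma involution_sq : g *m g = 1%:M.
Proof.
rewrite /g -!scalemxAl -!scalemxAr.
have [-> _] := @level_sumM 0 0 ltac:(lia) ltac:(lia).
rewrite subn0 max0n level_sum_last !scalerA U_card // subn0 expnM expnAC.
rewrite -mulnn natrM -[RHS]scale1r; congr (_ *: _); field.
exact: rN_neq0.
Qed.

Lemma chain_idem0 : c 0 = 1%:M.
Proof.
rewrite /c l_gt0 subn0 level_sum_last U_card // subnn muln0 expn0 invr1.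
exact: scale1r.
Qed.

Lemma chain_idem_trace i : (i < l)%N -> \tr (c i) = r%:R ^+ (N - 2 * i).
Proof.
move=> lt_il; rewrite /c lt_il mxtraceZ level_sum_trace weil_dim U_card; last by lia.
rewrite subKn; last by lia.
have -> : (r ^ N)%:R = (r ^ (N - 2 * i))%:R * (r ^ (2 * i))%:R :> C.
  by rewrite -natrM -expnD subnK //; lia.
by rewrite !natrX mulrC mulfK // expf_neq0 // pnatr_eq0 -lt0n ltnW.
Qed.

(** As the value is independent of [i], it cancels in [c i - c i.+1] when [i.+1 < l]; only the last
    pair of constituents has unequal ranks. *)
Lemma chain_involution_trace i : (i < l)%N -> \tr (c i *m g) = 1.
Proof.
move=> /involution_chain[_ ->]; rewrite mxtraceZ level_sum_trace weil_dim.
by rewrite mulVf.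
Qed.

Let two_neq0 : 2 != 0 :> C. Proof. by rewrite pnatr_eq0. Qed.

Lemma parity_projM b b' : p b *m p b' = if b == b' then p b else 0.
Proof.
have sgM : (-1) ^+ (~~ b) * (-1) ^+ (~~ b) = 1 :> C.
  by case: b; rewrite ?mulr1 // mulrNN mulr1.
rewrite /p; move: central_involution involution_sq => g' gg'.
rewrite -scalemxAl -scalemxAr mulmxDl mul1mx mulmxDr mulmx1.
rewrite -!scalemxAl -!scalemxAr gg' !scalerA.
case: eqP => [<-|/eqP neq_bb'].
  rewrite sgM scale1r [_ *: g' + 1%:M]addrC -mulr2n -scaler_nat scalerA.
  by congr (_ *: _); field.
have -> : (-1) ^+ (~~ b') = - (-1) ^+ (~~ b) :> C.
  by move: neq_bb' {sgM}; case: b b' => -[] //= _; rewrite ?opprK.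
by rewrite mulrN sgM !scaleNr scale1r addrA subrK subrr scaler0.
Qed.

Lemma parity_projC i b : p b *m c i = c i *m p b.
Proof.
have := involution_chainC i; rewrite /p; move: central_involution => g' g'c.
rewrite -scalemxAl -scalemxAr mulmxDl mulmxDr mul1mx mulmx1.
by rewrite -scalemxAl -scalemxAr g'c.
Qed.

Lemma parity_proj_sum : p true + p false = 1%:M.
Proof.
rewrite /p -scalerDr /= expr0 expr1 scale1r scaleN1r addrACA subrr addr0.
by rewrite -mulr2n -scaler_nat scalerA mulVf // scale1r.
Qed.

Lemma chain_weil_idem k j : c k *m weil_idem j = if (k <= j.1)%N then weil_idem j else 0.
Proof.
rewrite /weil_idem mulmxA mulmxBr.
case: leqP => [le_kj|lt_jk].
  have [-> _] := @chain_idemM k j.1 ltac:(lia).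
  by have [-> _] := @chain_idemM k j.1.+1 ltac:(lia).
have [_ ->] := @chain_idemM j.1 k ltac:(lia).
have [_ ->] := @chain_idemM j.1.+1 k ltac:(lia).
by rewrite subrr mul0mx.
Qed.

Lemma parity_weil_idem b j : p b *m weil_idem j = if b == j.2 then weil_idem j else 0.
Proof.
rewrite /weil_idem mulmxA mulmxBr !parity_projC -mulmxBl -mulmxA parity_projM.
by case: eqP => [->|_]; rewrite ?mulmx0.
Qed.

Lemma weil_idemM i j : weil_idem i *m weil_idem j = if i == j then weil_idem i else 0.
Proof.
rewrite {1}/weil_idem -mulmxA parity_weil_idem.
case: i j => [i b] [j b'] /=; rewrite xpair_eqE andbC /=.
case: (b =P b') => [->|_]; last by rewrite mulmx0.
rewrite mulmxBl !chain_weil_idem /= -val_eqE /=.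
by case: ltngtP => [||/val_inj ->]; rewrite ?subrr ?subr0.
Qed.

Lemma weil_idem_sum : \sum_j weil_idem j = 1%:M.
Proof.
rewrite -(pair_bigA _ (fun i b => weil_idem (i, b))) /=.
under eq_bigr => i _.
  rewrite big_bool /weil_idem /= -mulmxDr parity_proj_sum mulmx1.
  over.
rewrite -(big_mkord xpredT (fun i => c i - c i.+1)).
under eq_bigr => i _ do rewrite -opprB.
rewrite sumrN telescope_sumr // {1}/c ltnn sub0r opprK.
exact: chain_idem0.
Qed.

Let sum_commutant (A B : 'M[C]_d) (a b : C) : in_commutant W A -> in_commutant W B ->
  in_commutant W (a *: A + b *: B).
Proof.
move=> cA cB x Gx; rewrite mulmxDl mulmxDr -!scalemxAl -!scalemxAr.
by rewrite cA // cB.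
Qed.

Let mul_commutant (A B : 'M[C]_d) : in_commutant W A -> in_commutant W B ->
  in_commutant W (A *m B).
Proof. by move=> cA cB x Gx; rewrite -mulmxA cB // mulmxA cA // mulmxA. Qed.

Lemma weil_idem_commutant j : in_commutant W (weil_idem j).
Proof.
have cc i : in_commutant W (c i).
  rewrite /c; case: ifP => _; last by move=> x _; rewrite mul0mx mulmx0.
  by move=> x Gx; rewrite -scalemxAl -scalemxAr level_sum_commutant.
have cg : in_commutant W g.
  by move=> x Gx; rewrite -scalemxAl -scalemxAr level_sum_commutant.
have c1 : in_commutant W 1%:M by move=> x _; rewrite mul1mx mulmx1.
apply: mul_commutant.
  by rewrite -[c j.1]scale1r -scaleN1r; apply: sum_commutant.
by rewrite /p scalerDr scalerA; apply: sum_commutant.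
Qed.

(** Each [F k] is a multiple of [g *m c k] or of [c (N - k)], and [weil_idem j] is an eigenvector
    for both [g] and the [c i]. This supplies the hypothesis of [commutant_scalar]. *)
Lemma level_sum_weil_idem k j : (k <= N)%N ->
  exists a, F k *m weil_idem j = a *: weil_idem j.
Proof.
move=> le_kN.
have ca i : exists a, c i *m weil_idem j = a *: weil_idem j.
  rewrite chain_weil_idem; case: ifP => _.
    by exists 1; rewrite scale1r.
  by exists 0; rewrite scale0r.
have [b Hb] : exists b, g *m weil_idem j = b *: weil_idem j.
  exists ((-1) ^+ (~~ j.2)).
  have -> : g = p true - p false.
    rewrite /p -scalerBr /= expr0 expr1 scale1r scaleN1r opprD opprK addrACA subrr add0r.
    by rewrite -mulr2n -scaler_nat scalerA mulVf // scale1r.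
  rewrite mulmxBl !parity_weil_idem; case: (j.2) => /=.
    by rewrite subr0 scale1r.
  by rewrite sub0r scaleN1r.
have [lt_kl|le_lk] := ltnP k l.
  have [Hg _] := involution_chain lt_kl.
  have [a Ha] := ca k.
  exists ((r ^ N)%:R * (a * b)).
  rewrite -[F k](scalerKV rN_neq0) -Hg -scalemxAl -mulmxA Ha -scalemxAr Hb.
  by rewrite !scalerA mulrA.
have [a Ha] := ca (N - k)%N.
exists (#|U k|%:R * a); rewrite -scalerA -Ha /c.
have -> : (N - k < l)%N by lia.
by rewrite subKn // -!scalemxAl scalerKV.
Qed.

(** * Ranks of the idempotents, computed as traces *)

Lemma weil_idem_rank i b : (2 * \rank (weil_idem (i, b)))%:R =
  \tr (c i - c i.+1) + (-1) ^+ (~~ b) * \tr ((c i - c i.+1) *m g) :> C.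
Proof.
rewrite natrM -mxtrace_idempotent; last by rewrite weil_idemM eqxx.
rewrite /weil_idem /p; move: central_involution => g'.
rewrite -scalemxAr mxtraceZ mulrA divff // mul1r.
by rewrite mulmxDr mulmx1 [LHS]mxtraceD -scalemxAr mxtraceZ.
Qed.

Lemma weil_idem_rank_lt (i : 'I_l) b : (i.+1 < l)%N ->
  (2 * \rank (weil_idem (i, b)) = r ^ (2 * (l - i.+1) - 1) * (r ^ 2 - 1))%N.
Proof.
move=> lt_il; apply/eqP; rewrite -(eqr_nat C) weil_idem_rank mulmxBl !raddfB /=.
rewrite !chain_involution_trace ?(ltnW lt_il) // subrr mulr0 addr0.
rewrite !chain_idem_trace ?(ltnW lt_il) //.
have -> : (N - 2 * i = 2 * (l - i.+1) - 1 + 2)%N by lia.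
have -> : (N - 2 * i.+1 = 2 * (l - i.+1) - 1)%N by lia.
rewrite natrM natrB ?expn_gt0 ?(ltnW r_gt1) // !natrX exprD.
by rewrite mulrBr mulr1.
Qed.

Lemma weil_idem_rank_last (i : 'I_l) : i.+1 = l ->
  (2 * \rank (weil_idem (i, true)) = r + 1)%N /\
  (2 * \rank (weil_idem (i, false)) = r - 1)%N.
Proof.
move=> eq_il; have cl : c i.+1 = 0 by rewrite /c eq_il ltnn.
have e1 : (N - 2 * i = 1)%N by lia.
split; apply/eqP; rewrite -(eqr_nat C) weil_idem_rank cl subr0.
  by rewrite chain_idem_trace // chain_involution_trace // e1 mulr1 natrD.
by rewrite chain_idem_trace // chain_involution_trace // e1 mulr1 natrB ?(ltnW r_gt1).
Qed.

Lemma weil_idem_neq0 j : weil_idem j != 0.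
Proof.
case: j => i b; rewrite -mxrank_eq0 -lt0n -(ltn_pmul2l (isT : 0 < 2)%N) muln0.
have [lt_il|le_li] := ltnP i.+1 l.
  rewrite weil_idem_rank_lt // muln_gt0 expn_gt0 (ltnW r_gt1) subn_gt0.
  by rewrite -mulnn (leq_trans r_gt1) // leq_pmulr // ltnW.
have eq_il : i.+1 = l by apply/eqP; rewrite eqn_leq ltn_ord.
by have [e1 e2] := weil_idem_rank_last eq_il; case: b; rewrite ?e1 ?e2; lia.
Qed.

Theorem filtered_weil_constituents :
  exists X : 'I_l * bool -> 'M[C]_d,
    [/\ forall j, mxsimple W (X j),
        mxdirect (\sum_j X j) /\ (\sum_j X j :=: 1%:M)%MS,
        forall j1 j2, j1 != j2 -> ~ mx_iso W (X j1) (X j2),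
        forall (i : 'I_l) (b : bool), (i.+1 < l)%N ->
          (2 * \rank (X (i, b)) = r ^ (2 * (l - i.+1) - 1) * (r ^ 2 - 1))%N
      & forall i : 'I_l, i.+1 = l ->
          (2 * \rank (X (i, true)) = r + 1)%N /\
          (2 * \rank (X (i, false)) = r - 1)%N].
Proof.
have charG : ([pchar C]^'.-group [set: Sp f])%g.
  by rewrite /pgroup pcharf'_nat pnatr_eq0 -lt0n cardG_gt0.
have scal A : in_commutant W A -> forall j, exists a, A *m weil_idem j = a *: weil_idem j.
  move=> comA j; apply: commutant_scalar => // k le_kN.
  exact: level_sum_weil_idem.
exists weil_idem; split.
- exact: commutant_mxsimple charG weil_idemM weil_idem_neq0 weil_idem_commutant scal.
- split; first exact: commutant_direct weil_idemM.
  exact: commutant_sum weil_idem_sum.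
- move=> j1 j2.
  exact: commutant_non_iso weil_idemM weil_idem_neq0 weil_idem_commutant scal _ _.
- exact: weil_idem_rank_lt.
- exact: weil_idem_rank_last.
Qed.

End FilteredWeil.

(** * Orbits of the symplectic group *)

Section SymplecticOrbits.
Variables (R : finComNzRingType) (M : finLmodType R) (f : {biscalar M}).
Hypothesis fvv : forall v, f v v = 0.
Hypothesis f_nondeg : forall v, (forall u, f v u = 0) -> v = 0.

(** Nondegeneracy makes an isometry injective, hence a permutation of the finite set [M]. *)
Lemma isometry_Sp (t : M -> M) :
    (forall u v, t (u + v) = t u + t v) -> (forall a u, t (a *: u) = a *: t u) ->
    (forall u v, f (t u) (t v) = f u v) ->
  exists g : Sp f, forall v, g v = t v.
Proof.
move=> tD tZ tf.
have t_inj : injective t.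
  move=> u v tuv; apply/eqP; rewrite -subr_eq0; apply/eqP; apply: f_nondeg => w.
  by rewrite linearBl -(tf u) -(tf v) tuv subrr.
have g_sp : symplectic f (perm t_inj).
  by apply/and3P; split; do 2!apply/forallP=> ?; rewrite !permE ?tD ?tZ ?tf.
by exists (exist _ (perm t_inj) g_sp : Sp f) => v; apply: permE.
Qed.

Variables (P : {set M}) (c : R).
Hypothesis P_submodule : submodule_set P.
Hypothesis f_div : forall u x, u \in P -> exists a, f u x = a * c.
Hypothesis P_ann : forall u a, u \in P -> a * c = 0 -> a *: u = 0.

(* The transvection [x |-> x - f (u, x) / f (v, w) u] with [u = w - v] sends [v]
   to [w]; the quotient by [c] common to both values is determined only up to
   the annihilator of [u]. *)
Lemma transvection_orbit v w a b : v \in P -> w \in P ->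
  f v w = a * c -> a * b = 1 -> exists g : Sp f, g v = w.
Proof.
have [_ PD _] := P_submodule.
move=> Pv Pw fvw ab.
have [u Pu defu] : exists2 u, u \in P & u = w - v.
  by exists (w - v); rewrite ?PD ?submodule_setN.
have /fin_all_exists[e He] := fun x => f_div x Pu.
have eu x y : x * c = y * c -> x *: u = y *: u.
  move=> xy; apply/eqP; rewrite -subr_eq0 -scalerBl; apply/eqP.
  by apply: P_ann; rewrite // mulrBl xy subrr.
have [g Hg] : exists g : Sp f, forall x, g x = x - (b * e x) *: u.
  apply: isometry_Sp => [x y|r x|x y].
  - rewrite -addrACA -opprD -scalerDl -mulrDr; congr (_ - _).
    rewrite -!(scalerA b); congr (_ *: _); apply: eu.
    by rewrite -He mulrDl -!He linearDr.
  - rewrite scalerBr scalerA; congr (_ - _).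
    rewrite mulrCA -!(scalerA b); congr (_ *: _); apply: eu.
    by rewrite -He -mulrA -He linearZr.
  - rewrite linearBl /= !linearBr /= !linearZl !linearZr /= fvv.
    by rewrite (alternatingC fvv x u) !He; ring.
exists g; rewrite Hg.
have -> : (b * e v) *: u = - u.
  rewrite -scaleN1r -scalerA -ab mulrC -mulrN -scalerA; congr (_ *: _); apply: eu.
  by rewrite -He defu linearBl /= fvv subr0 (alternatingC fvv) fvw mulNr.
by rewrite opprK defu addrC subrK.
Qed.

Variable p : R.
Hypothesis R_local : forall a, (exists b, a * b = 1) \/ exists b, a = b * p.

(** If [x = a * c] fails this test, then [a] is a unit by [R_local], as the transvection
    requires. *)
Definition div_next (x : R) : bool := [exists a, x == a * p * c].

Lemma div_nextB x y : div_next x -> div_next y -> div_next (x - y).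
Proof.
move=> /existsP[a /eqP->] /existsP[b /eqP->]; apply/existsP; exists (a - b).
by rewrite !mulrBl.
Qed.

(** The pairing of [v] with [w] may be too divisible for one transvection; two of them, through a
    common [z] pairing well with both, suffice. *)
Lemma symplectic_orbit v w zv zw : v \in P -> w \in P -> zv \in P -> zw \in P ->
    ~~ div_next (f v zv) -> ~~ div_next (f w zw) ->
  exists g : Sp f, g v = w.
Proof.
move=> Pv Pw Pzv Pzw nv nw.
have step x y : x \in P -> y \in P -> ~~ div_next (f x y) -> exists g : Sp f, g x = y.
  move=> Px Py; have [a fxy] := f_div y Px.
  have [[b ab] _|[b ab]] := R_local a; first exact: transvection_orbit fxy ab.
  by case/existsP; exists b; rewrite fxy ab.
have divC x y : div_next (f x y) = div_next (f y x).
  have N x' : div_next x' -> div_next (- x').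
    by case/existsP=> a /eqP->; apply/existsP; exists (- a); rewrite !mulNr.
  by rewrite (alternatingC fvv); apply/idP/idP=> /N; rewrite ?opprK.
(* If neither [zw] nor [zv] serves both vectors, their sum does, since each pairing then has exactly
   one term divisible by [p * c]. *)
have [z [Pz nvz nwz]] : exists z, [/\ z \in P, ~~ div_next (f v z) & ~~ div_next (f w z)].
  have [dv|] := boolP (div_next (f v zw)); last by exists zw.
  have [dw|] := boolP (div_next (f w zv)); last by exists zv.
  have [_ PD _] := P_submodule; exists (zv + zw); split; first exact: PD.
    by apply: contra nv => /div_nextB/(_ dv); rewrite linearDr addrK.
  by apply: contra nw => /div_nextB/(_ dw); rewrite linearDr addrAC subrr add0r.
have [g1 <-] : exists g : Sp f, g z = w by apply: step; rewrite // divC.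
have [g2 <-] := step _ _ Pv Pz nvz.
by exists (g1 * g2)%g; rewrite [LHS]permM.
Qed.

End SymplecticOrbits.

(** * Forms over a ramified quadratic extension *)

Section ChainRingFiltration.
Variables (R : finComNzRingType) (A : finComUnitRingType).
Variables (iota : {rmorphism R -> A}) (star : {rmorphism A -> A}).
Variables (p : R) (w : A) (l n : nat).
Local Notation N := (2 * l - 1)%N.
Hypothesis l_gt0 : (0 < l)%N.
Hypotheses (iota_p : iota p = w ^+ 2) (iota_inj : injective iota).
Hypothesis A_decomp : forall a, exists r r', a = iota r + iota r' * w.
Hypotheses (wN : w ^+ N = 0)
  (w_div : forall j a, (j <= N)%N -> w ^+ j * a = 0 -> exists b, a = w ^+ (N - j) * b).
Hypothesis p_div :
  forall j a, (j <= l)%N -> p ^+ j * a = 0 -> exists b, a = p ^+ (l - j) * b.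
Hypothesis R_local : forall a : R, (exists b, a * b = 1) \/ exists b, a = b * p.
Hypothesis two_inv : exists b : R, 2%:R * b = 1.
Hypotheses (star_iota : forall r, star (iota r) = iota r) (star_w : star w = - w).
Variables (k : finType) (tau : k -> A).
Hypotheses (tau_onto : forall a, exists x b, a = tau x + w * b)
  (tau_inj : forall x y, w ^+ N.-1 * (tau x - tau y) = 0 -> x = y).

Variable V : finLmodType A.
Hypothesis V_free : free_of_rank V n.
Variable h : V -> V -> A.
Hypothesis h_form : nondegenerate_skew_hermitian star h.
Variable f : {biscalar (restr iota V)}.
Hypothesis f_def : forall v u, iota (f v u) = (h v u + star (h v u)) / 2%:R.

Definition torsion (i : nat) : {set A} := [set a | w ^+ i * a == 0].

(** Leading digits: an element of [torsion i.+1] is uniquely [w ^+ (N - i.+1) * tau x] plus an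
    element of [torsion i]. *)
Lemma card_torsion i : (i <= N)%N -> #|torsion i| = (#|k| ^ i)%N.
Proof.
elim: i => [|i IH] lt_iN.
  apply/eqP/cards1P; exists 0; apply/setP=> a; by rewrite !inE expr0 mul1r.
rewrite expnS -(IH (ltnW lt_iN)) -cardsT -cardsX.
rewrite -(card_in_imset (f := fun xa => w ^+ (N - i.+1) * tau xa.1 + xa.2)); last first.
  move=> [x a] [y b]; rewrite !inE /= => /eqP a0 /eqP b0 eq_xy.
  have e : w ^+ (N - i.+1) * (tau x - tau y) = b - a.
    rewrite mulrBr; apply/eqP; rewrite subr_eq addrAC [b + _]addrC.
    by rewrite -[_ + b]eq_xy /= addrK.
  have exy : x = y.
    apply: tau_inj; have -> : N.-1 = (i + (N - i.+1))%N by lia.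
    by rewrite exprD -mulrA e mulrBr a0 b0 subrr.
  by congr (_, _) => //; move: eq_xy; rewrite exy => /addrI.
congr #|pred_of_set _|; apply/setP=> a; rewrite inE; apply/eqP/imsetP.
  move=> a0; have [b ->] := w_div lt_iN a0.
  have [x [b' ->]] := tau_onto b.
  exists (x, w ^+ (N - i) * b').
    by rewrite !inE /= mulrA -exprD subnKC ?(ltnW lt_iN) // wN mul0r.
  by rewrite /= mulrDr mulrA -exprSr subnSK.
case=> [[x b]]; rewrite !inE /= => /eqP b0 ->.
by rewrite mulrDr mulrA -exprD subnKC // wN mul0r add0r exprS -mulrA b0 mulr0.
Qed.

Local Notation VR := (restr iota V).

(** This is [w ^+ j *: V], by [levelP] and [levelM], written as an annihilator so that membership is
    a boolean equation. *)
Definition level (j : nat) : {set VR} :=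
  [set v : VR | w ^+ (N - j) *: (v : V) == 0].

Lemma levelP j v : (j <= N)%N ->
  v \in level j -> exists u : V, v = w ^+ j *: u.
Proof.
move=> le_jN; rewrite inE => /eqP wv0; have [b bP] := V_free.
have [c [defv _]] := bP v.
have [c0 [_ c0_uniq]] := bP 0.
have c0E : c0 = 0.
  by apply: c0_uniq; rewrite big1 // => i _; rewrite mxE scale0r.
have wc i : w ^+ (N - j) * c 0 i = 0.
  have /c0_uniq : 0 = \sum_i (w ^+ (N - j) *: c) 0 i *: b i.
    rewrite -[LHS]wv0 [X in _ *: X]defv scaler_sumr; apply: eq_bigr => i' _.
    by rewrite scalerA mxE.
  by rewrite c0E => /rowP/(_ i); rewrite !mxE.
have /fin_all_exists[e He] := fun i => w_div (leq_subr j N) (wc i).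
exists (\sum_i e i *: b i); rewrite defv scaler_sumr; apply: eq_bigr => i _.
by rewrite scalerA He subKn.
Qed.

Lemma levelM j (u : V) : (w ^+ j *: u : VR) \in level j.
Proof.
rewrite inE scalerA -exprD; apply/eqP.
have -> : (N - j + j = N + (j - N))%N by lia.
by rewrite exprD wN mul0r scale0r.
Qed.

(** In coordinates the level consists of [n] copies of [torsion (N - j)]. *)
Lemma card_level j : (j <= N)%N -> #|level j| = (#|k| ^ (n * (N - j)))%N.
Proof.
move=> le_jN; have [b bP] := V_free.
pose F (c : {ffun 'I_n -> A}) : V := \sum_i c i *: b i.
have FE c : F c = \sum_i (\row_j c j) 0 i *: b i.
  by apply: eq_bigr => i _; rewrite mxE.
have F_inj : injective F.
  move=> c c' eqF; have [d [_ d_uniq]] := bP (F c).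
  have /rowP e : \row_j c j = \row_j c' j.
    by rewrite -(d_uniq _ (FE c)); apply: d_uniq; rewrite eqF FE.
  by apply/ffunP=> i; have := e i; rewrite !mxE.
rewrite mulnC expnM -card_torsion ?leq_subr // -[in RHS](card_ord n) -card_ffun_on.
rewrite -(card_imset _ F_inj); apply: eq_card => v.
apply/idP/imsetP => [/(levelP le_jN)[u ->]|[c /ffun_onP Tc ->]].
  have [c [-> _]] := bP u.
  exists [ffun i => w ^+ j * c 0 i].
    apply/ffun_onP=> i; rewrite ffunE inE mulrA -exprD subnK //.
    by rewrite wN mul0r.
  rewrite /F scaler_sumr; apply: eq_bigr => i _.
  by rewrite ffunE scalerA.
rewrite inE scaler_sumr big1 // => i _; rewrite scalerA.
by have := Tc i; rewrite inE => /eqP->; rewrite scale0r.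
Qed.

(** * The trace form [f] and its orthogonality relations *)

Let hZr a v u : h v (a *: u) = a * h v u. Proof. by case: h_form. Qed.
Let hZl a v u : h (a *: v) u = star a * h v u.
Proof. by case: h_form => _ _ []. Qed.
Let hC v u : h v u = - star (h u v). Proof. by case: h_form. Qed.
Let h_nondeg v : (forall u, h v u = 0) -> v = 0.
Proof.
move=> hv0; have [_ _ _ _ h_inj] := h_form; apply: h_inj => u.
by rewrite hv0 -[in RHS](scale0r 0) hZl rmorph0 mul0r.
Qed.

Let two_cancel (B : comNzRingType) (F : {rmorphism R -> B}) (x : B) :
  x + x = 0 -> x = 0.
Proof.
have [b /(congr1 F)] := two_inv; rewrite rmorphM rmorph1 rmorph_nat => Fb.
by rewrite -mulr2n -mulr_natl => x0; rewrite -[x]mul1r -Fb mulrAC x0 mul0r.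
Qed.

Lemma two_regular (x : R) : x + x = 0 -> x = 0.
Proof. exact: (two_cancel idfun). Qed.

Let two_unit : (2%:R : A) \is a GRing.unit.
Proof.
have [b /(congr1 iota)] := two_inv; rewrite rmorphM rmorph1 rmorph_nat => Fb.
by apply/unitrP; exists (iota b); rewrite mulrC Fb.
Qed.

Let f2 v u : iota (f v u) + iota (f v u) = h v u + star (h v u).
Proof. by rewrite -mulr2n -mulr_natr f_def divrK. Qed.

Let f_eq0 v u : h v u = 0 -> f v u = 0.
Proof.
move=> hvu; apply: iota_inj; rewrite rmorph0; apply: (two_cancel iota).
by rewrite f2 hvu rmorph0 addr0.
Qed.

Lemma trace_form_alternating v : f v v = 0.
Proof.
apply: iota_inj; rewrite rmorph0; apply: (two_cancel iota).
by rewrite f2 {1}hC addNr.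
Qed.

(** For [x = h v u], the cases [a = 1] and [a = w] give [star x = - x] and [w * x = 0], so [x] is a
    multiple of [w ^+ N.-1]. As [N.-1] is even and [w ^+ N = 0], such an [x] lies in [R], where
    [star] is trivial; hence [x + x = 0]. *)
Lemma trace_form_perp v u : (forall a : A, f v (a *: (u : V) : V) = 0) -> h v u = 0.
Proof.
move=> fa; set x := h v u.
have x1 : x + star x = 0 by rewrite -f2 -[u]scale1r fa rmorph0 addr0.
have x2 : w * x - w * star x = 0.
  have := f2 v (w *: (u : V)); rewrite fa rmorph0 addr0 hZr rmorphM star_w.
  by rewrite mulNr.
have wx : w ^+ 1 * x = 0.
  apply: (two_cancel iota); rewrite -[RHS]x2 expr1; congr (_ + _).
  by rewrite -mulrN; congr (_ * _); apply/eqP; rewrite -addr_eq0 x1.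
have le_1N : (1 <= N)%N by lia.
have [b xb] := w_div le_1N wx.
have [r [r' bE]] := A_decomp b.
have N1 : (N - 1 = 2 * l.-1)%N by lia.
have xr : x = iota (p ^+ l.-1 * r).
  rewrite xb bE mulrDr N1 rmorphM rmorphXn iota_p -exprM [X in _ + X]mulrCA.
  by rewrite -exprSr -N1 subn1 prednK // wN mulr0 addr0.
by apply: (two_cancel iota); rewrite -[in RHS]x1 xr star_iota.
Qed.

Let pl0 : p ^+ l = 0.
Proof.
apply: iota_inj; rewrite rmorph0 rmorphXn iota_p -exprM.
have -> : (2 * l = N + 1)%N by lia.
by rewrite exprD wN mul0r.
Qed.

Lemma star_wX j : star (w ^+ j) = (-1) ^+ j * w ^+ j.
Proof. by rewrite rmorphXn star_w [LHS]exprNn. Qed.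

(** The levels are stable under [A], so [trace_form_perp] replaces [f] by [h]; there [w ^+ j] moves
    across the form up to sign, and [h] is nondegenerate. *)
Lemma perp_level j : (j <= N)%N -> perp f (level j) = level (N - j).
Proof.
move=> le_jN; apply/setP=> v; rewrite !inE subKn //.
apply/forall_inP/eqP => [fv0 | wv0 _ /(levelP le_jN)[u ->]].
  apply: h_nondeg => u; rewrite hZl star_wX -mulrA -hZr.
  suff -> : h v (w ^+ j *: u) = 0 by rewrite mulr0.
  apply: trace_form_perp => a; apply/eqP/fv0.
  by rewrite scalerA mulrC -scalerA levelM.
apply/eqP/f_eq0; rewrite hZr.
have : star (w ^+ j) * h v u = 0.
  by rewrite -hZl wv0 -[X in h X _](scale0r 0) hZl rmorph0 mul0r.
by rewrite star_wX -mulrA => e; rewrite -[LHS](signrMK j) e mulr0.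
Qed.

Lemma level_last : level N = [set 0].
Proof. by apply/setP=> v; rewrite !inE subnn expr0 scale1r. Qed.

Lemma level_first : level 0 = setT.
Proof. by apply/setP=> v; rewrite !inE subn0 wN scale0r eqxx. Qed.

Lemma trace_form_nondeg v : (forall u, f v u = 0) -> v = 0.
Proof.
move=> fv0; apply/set1P; rewrite -level_last -[in X in level X](subn0 N) -perp_level //.
by rewrite inE; apply/forall_inP=> u _; rewrite fv0.
Qed.

Lemma level_submodule j : submodule_set (level j).
Proof.
split=> [|u v|a v]; rewrite ?inE; first by rewrite scaler0.
  by move=> /eqP u0 /eqP v0; rewrite scalerDr u0 v0 addr0.
move=> /eqP v0; apply/eqP.
by rewrite -[a *: v]/(iota a *: (v : V)) scalerA mulrC -scalerA v0 scaler0.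
Qed.

Lemma level_decr i j : (i <= j)%N -> level j \subset level i.
Proof.
move=> le_ij; apply/subsetP=> v; rewrite !inE => /eqP v0.
by rewrite -(subnK (leq_sub2l N le_ij)) exprD -scalerA v0 scaler0.
Qed.

Let scale_p i (v : VR) : p ^+ i *: v = w ^+ (2 * i) *: (v : V) :> V.
Proof. by rewrite -[LHS]/(iota (p ^+ i) *: (v : V)) rmorphXn iota_p -exprM. Qed.

Let SpZ (g : Sp f) a v : g (a *: v) = a *: g v.
Proof. by case/and3P: (valP g) => _ /forallP/(_ a)/forallP/(_ v)/eqP. Qed.

(** Elements of [Sp f] commute with [p] but not necessarily with [w]. As [N] is odd, either [j] is
    even and the level is the image of a power of [p], or [N - j] is even and it is the kernel of
    one. *)
Lemma level_stable j (g : Sp f) : {in level j, forall v, g v \in level j}.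
Proof.
have [ev | od] := boolP (odd (N - j)).
  have le_jN : (j <= N)%N by lia.
  have [i ji] : exists i, j = (2 * i)%N by exists j./2; lia.
  move=> v /(levelP le_jN)[u ->]; rewrite ji -scale_p SpZ scale_p -ji.
  exact: levelM.
have [i ji] : exists i, (N - j = 2 * i)%N by exists (N - j)./2; lia.
move=> v; rewrite !inE ji -!scale_p -SpZ => /eqP->.
by rewrite -[X in g X](scale0r (0 : VR)) SpZ scale0r.
Qed.

Lemma level_orbit_low e v u : (e <= 1)%N -> (e < N)%N ->
    v \in level e :\: level e.+1 -> u \in level e :\: level e.+1 ->
  exists g : Sp f, g v = u.
Proof.
move=> le_e1 lt_eN.
have le_el : (e < l)%N by lia.
have ann (u' : VR) : u' \in level e -> p ^+ (l - e) *: u' = 0.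
  rewrite inE scale_p => /eqP wu0.
  (* The bound [e <= 1] is what gives [N - e <= 2 * (l - e)]. *)
  have -> : (2 * (l - e) = (2 * (l - e) - (N - e)) + (N - e))%N by lia.
  by rewrite exprD -scalerA wu0 scaler0.
have f_div u' x : u' \in level e -> exists a, f u' x = a * p ^+ e.
  move=> /ann pu0; have [|a ->] := p_div (leq_subr e l) (a := f u' x).
    by rewrite -linearZl /= pu0 linear0l.
  by exists a; rewrite subKn 1?mulrC // ltnW.
have P_ann u' a : u' \in level e -> a * p ^+ e = 0 -> a *: u' = 0.
  move=> /ann pu0; rewrite mulrC => /(p_div (ltnW le_el))[b ->].
  by rewrite mulrC -scalerA pu0 scaler0.
(* If every pairing of [v'] with [level e] were divisible by [p ^+ e.+1], then [v'] would be
   orthogonal to [level (N - e.+1)], which is [p ^+ (l - e.+1)] times [level e], and so lie in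
   [level e.+1]. *)
have witness v' : v' \in level e :\: level e.+1 ->
    exists2 z, z \in level e & ~~ div_next (p ^+ e) p (f v' z).
  rewrite inE => /andP[nv' _]; apply/exists_inP; rewrite -[X in is_true X]negbK.
  apply: contra nv' => /exists_inPn /= nz.
  have le_N : (N - e.+1 <= N)%N by apply: leq_subr.
  rewrite -(subKn lt_eN) -(perp_level le_N) inE.
  apply/forall_inP => x /(levelP le_N)[y ->].
  have : w ^+ e *: y \in level e by apply: levelM.
  move/nz; rewrite negbK => /existsP[a /eqP fa].
  have -> : (N - e.+1 = 2 * (l - e.+1) + e)%N by lia.
  rewrite exprD -scalerA -scale_p linearZr /= fa.
  have -> : p ^+ (l - e.+1) * (a * p * p ^+ e) = a * p ^+ l.
    by rewrite -[in RHS](subnK le_el) exprD exprS; ring.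
  by rewrite pl0 mulr0.
move=> Hv Hu; have [zv Pzv nv] := witness _ Hv; have [zu Pzu nu] := witness _ Hu.
have [/setDP[Pv _] /setDP[Pu _]] := (Hv, Hu).
exact: (symplectic_orbit trace_form_alternating trace_form_nondeg
  (level_submodule e) f_div P_ann R_local Pv Pu Pzv Pzu nv nu).
Qed.

(** Division by [p ^+ j./2], with which [Sp f] commutes, leaves only the levels 0 and 1. *)
Lemma level_orbit j v u : v \in level j :\: level j.+1 ->
  u \in level j :\: level j.+1 -> (j < N)%N -> exists g : Sp f, g v = u.
Proof.
move=> Hv Hu lt_jN; pose e := odd j : nat.
have [e_le1 je] : (e <= 1)%N /\ (j = 2 * j./2 + e)%N by rewrite /e; lia.
have reduce x : x \in level j :\: level j.+1 ->
    exists2 y : VR, y \in level e :\: level e.+1 & x = p ^+ j./2 *: y.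
  case/setDP=> /(levelP (ltnW lt_jN))[y ->] nx.
  exists (w ^+ e *: y); last by rewrite scale_p scalerA -exprD -je.
  rewrite in_setD levelM andbT; apply: contra nx; rewrite !inE !scalerA -!exprD.
  move=> /eqP y0; apply/eqP.
  have -> : (N - j.+1 + j = N - e.+1 + e)%N by lia.
  exact: y0.
have [v' Hv' ->] := reduce v Hv; have [u' Hu' ->] := reduce u Hu.
have [g <-] := level_orbit_low e_le1 ltac:(lia) Hv' Hu'.
by exists g; rewrite SpZ.
Qed.

End ChainRingFiltration.

(** * Arithmetic in the quadratic extension of [O] by [t] with [t ^+ 2 = s] *)

Section Ramified.
Variables (O : idomainType) (s : O).
Local Notation m := ('X^2 - s%:P).
Local Notation t := (ramt s).

Let mk_m : mk_monic m = m.
Proof. by rewrite /mk_monic size_XnsubC // monicXnsubC. Qed.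

Definition ram_const : {rmorphism O -> ramified s} := in_qpoly m \o polyC.

Lemma ramtM : t * t = ram_const s.
Proof.
rewrite -in_qpolyM.
have -> : 'X * 'X = m + s%:P by rewrite subrK.
rewrite in_qpolyD -[RHS]add0r; congr (_ + _); apply/val_inj => /=.
by rewrite mk_m Pdiv.RingMonic.rmodpp // monicXnsubC.
Qed.

Lemma ramt_even i : t ^+ (2 * i) = ram_const (s ^+ i).
Proof. by rewrite [LHS]exprM [t ^+ 2]expr2 ramtM rmorphXn. Qed.

Let val_small (u : {poly O}) : (size u < 3)%N -> val (in_qpoly m u) = u.
Proof. by move=> su; rewrite [LHS]in_qpoly_small // mk_m size_XnsubC. Qed.

Lemma ram_decomp (x : ramified s) : exists a b, x = ram_const a + ram_const b * t.
Proof.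
have sx : (size (val x) <= 2)%N.
  by rewrite -ltnS (leq_trans (size_mk_monic x)) // mk_m size_XnsubC.
exists (val x)`_0, (val x)`_1; rewrite -in_qpolyM -in_qpolyD.
have -> : ((val x)`_0)%:P + ((val x)`_1)%:P * 'X = val x.
  apply/polyP=> -[|[|i]]; rewrite coefD coefC coefCM coefX ?mulr0 ?mulr1 ?addr0 ?add0r //.
  by rewrite nth_default // (leq_trans sx).
by apply/val_inj; rewrite val_small.
Qed.

Lemma ram_eq0 a b : ram_const a + ram_const b * t = 0 -> a = 0 /\ b = 0.
Proof.
rewrite -in_qpolyM -in_qpolyD => /(congr1 val); rewrite val_small.
  move=> /polyP e; split.
    by have := e 0%N; rewrite coefD coefC coefCM coefX /= mulr0 addr0 coef0.
  by have := e 1%N; rewrite coefD coefC coefCM coefX /= mulr1 add0r coef0.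
by rewrite addrC size_MXaddC; case: ifP => // _; rewrite !ltnS size_polyC_leq1.
Qed.

Hypothesis s_neq0 : s != 0.

Lemma ramt_regular x : t * x = 0 -> x = 0.
Proof.
have [a [b ->]] := ram_decomp x => e.
have [sb a0] : s * b = 0 /\ a = 0.
  apply: ram_eq0; rewrite -[RHS]e rmorphM -ramtM; ring.
move/eqP: sb; rewrite mulf_eq0 (negPf s_neq0) a0 => /eqP->.
by rewrite !rmorph0 mul0r addr0.
Qed.

Lemma ramtX_regular i x : t ^+ i * x = 0 -> x = 0.
Proof.
elim: i => [|i IH]; first by rewrite expr0 mul1r.
by rewrite [t ^+ _]exprS -mulrA => /ramt_regular/IH.
Qed.

End Ramified.

Lemma nilpotent_unit (R : comNzRingType) (x : R) (l : nat) :
  x ^+ l = 0 -> exists y, (1 + x) * y = 1.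
Proof.
move=> xl; exists (\sum_(i < l) (- x) ^+ i).
have := subrX1 (- x) l; rewrite exprNn xl mulr0 sub0r => e.
by apply: oppr_inj; rewrite e -mulNr opprD addrC.
Qed.

(** * The quotients [R] and [A] as finite chain rings *)

Section ChainRings.
Variables (O : idomainType) (s : O) (k : finFieldType) (prk : {rmorphism O -> k}).
Hypotheses (s_neq0 : s != 0) (k_quotient : is_quotient prk (principal s)).
Variables (l : nat) (R : finComNzRingType) (prR : {rmorphism O -> R}).
Hypotheses (l_gt0 : (0 < l)%N) (R_quotient : is_quotient prR (principal (s ^+ l))).
Variables (A : finComUnitRingType) (prA : {rmorphism ramified s -> A}).
Local Notation t := (ramt s).
Local Notation N := (2 * l - 1)%N.
Hypothesis A_quotient : is_quotient prA (principal (t ^+ N)).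
Variable iota : {rmorphism R -> A}.
Hypothesis iota_pr : forall c, iota (prR c) = prA (ram_const s c).

Let p := prR s.
Let w := prA t.

Let prR_eq0 x : prR x = 0 -> exists y, x = y * s ^+ l.
Proof. by case: R_quotient => _ /(_ x)[]. Qed.
Let prR_ker x : prR (x * s ^+ l) = 0.
Proof. by case: R_quotient => _ /(_ (x * s ^+ l))[_]; apply; exists x. Qed.
Let prA_eq0 x : prA x = 0 -> exists y, x = y * t ^+ N.
Proof. by case: A_quotient => _ /(_ x)[]. Qed.
Let prA_ker x : prA (x * t ^+ N) = 0.
Proof. by case: A_quotient => _ /(_ (x * t ^+ N))[_]; apply; exists x. Qed.
Let prR_onto y : exists x, prR x = y. Proof. by case: R_quotient. Qed.
Let prA_onto y : exists x, prA x = y. Proof. by case: A_quotient. Qed.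
Let prk_onto y : exists x, prk x = y. Proof. by case: k_quotient. Qed.

Lemma uniformizer_nilpotent : w ^+ N = 0.
Proof. by rewrite -rmorphXn -[t ^+ N]mul1r prA_ker. Qed.

(** Lifted to [ramified s], the equation says that [t ^+ N] divides [t ^+ j * x], and the regular
    element [t ^+ j] cancels. *)
Lemma uniformizer_div j a : (j <= N)%N -> w ^+ j * a = 0 ->
  exists b, a = w ^+ (N - j) * b.
Proof.
have [x <-] := prA_onto a => le_jN; rewrite -rmorphXn -rmorphM => /prA_eq0[y e].
exists (prA y); rewrite -rmorphXn -rmorphM; congr (prA _).
apply/eqP; rewrite -subr_eq0; apply/eqP; apply: (ramtX_regular s_neq0 (i := j)).
by rewrite mulrBr e mulrA -[t ^+ j * _]exprD subnKC // mulrC subrr.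
Qed.

Lemma base_uniformizer_div j a : (j <= l)%N -> p ^+ j * a = 0 ->
  exists b, a = p ^+ (l - j) * b.
Proof.
have [x <-] := prR_onto a => le_jl; rewrite -rmorphXn -rmorphM => /prR_eq0[y e].
exists (prR y); rewrite -rmorphXn -rmorphM; congr (prR _).
apply: (mulfI (expf_neq0 j s_neq0)).
by rewrite e mulrA -exprD subnKC // mulrC.
Qed.

Lemma embedding_uniformizer : iota p = w ^+ 2.
Proof. by rewrite iota_pr -ramtM rmorphM. Qed.

(** Since [t ^+ N = s ^+ l.-1 * t], the constant coordinate of [(a + b * t) * t ^+ N] is
    [b * s ^+ l], which vanishes in [R]. *)
Lemma embedding_inj : injective iota.
Proof.
apply: raddf_inj => x; have [c <-] := prR_onto x.
move=> e0; have: prA (ram_const s c) = 0 by rewrite -iota_pr; apply: e0.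
move=> /prA_eq0[y]; have [a [b ->]] := ram_decomp y => e.
have tN : t ^+ N = ram_const s (s ^+ l.-1) * t.
  have -> : N = (2 * l.-1).+1 by lia.
  by rewrite [LHS]exprSr ramt_even.
have sl : s ^+ l = s ^+ l.-1 * s by rewrite -exprSr prednK.
have [c0 _] : c - b * s ^+ l = 0 /\ - (a * s ^+ l.-1) = 0.
  apply: (@ram_eq0 _ s); rewrite rmorphB rmorphN e tN sl !rmorphM -ramtM.
  by rewrite !rmorphXn; ring.
by rewrite -(prR_ker b); congr (prR _); apply/eqP; rewrite -subr_eq0 c0.
Qed.

Lemma ramified_decomp a : exists r r', a = iota r + iota r' * w.
Proof.
have [x <-] := prA_onto a; have [b [c ->]] := ram_decomp x.
by exists (prR b), (prR c); rewrite !iota_pr rmorphD rmorphM.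
Qed.

(** Lifting the inverse from [k] gives [x * y = 1 + z * s], whose second term becomes nilpotent in
    [R]. *)
Lemma prR_unit x : prk x != 0 -> exists y, prR x * y = 1.
Proof.
move=> nz; have [y ey] := prk_onto (prk x)^-1.
have [_ /(_ (x * y - 1))[]] := k_quotient.
case; first by rewrite rmorphB rmorphM ey rmorph1 divff // subrr.
move=> z ez _; have [|v ev] := @nilpotent_unit _ (prR (z * s)) l.
  by rewrite -rmorphXn exprMn prR_ker.
exists (prR y * v); rewrite mulrA -rmorphM -ev; congr (_ * _).
by rewrite -[x * y](subrK 1) ez rmorphD rmorph1 addrC.
Qed.

Lemma base_local (a : R) : (exists b, a * b = 1) \/ exists b, a = b * p.
Proof.
have [x <-] := prR_onto a.
have [x0|/prR_unit] := eqVneq (prk x) 0; last by left.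
have [_ /(_ x)[/(_ x0)[y ->] _]] := k_quotient.
by right; exists (prR y); rewrite rmorphM.
Qed.

Lemma base_two_inv : (forall c, c \in [pchar k] -> odd c) -> exists b : R, 2%:R * b = 1.
Proof.
move=> k_odd; rewrite -(rmorph_nat prR); apply: prR_unit.
rewrite rmorph_nat; apply/eqP => two0.
by have := k_odd 2%N; rewrite !inE two0 eqxx => /(_ isT).
Qed.

(** Any set-theoretic section of [prk] works: if two lifts are congruent modulo [t], comparing
    constant coordinates makes them congruent modulo [s]. *)
Lemma residue_lift : exists tau : k -> A,
  (forall a, exists x b, a = tau x + w * b) /\
  (forall x y, w ^+ N.-1 * (tau x - tau y) = 0 -> x = y).
Proof.
have /fin_all_exists[sec secK] := prk_onto.
exists (fun x => prA (ram_const s (sec x))); split=> [a|x y].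
  have [z <-] := prA_onto a; have [b [c ->]] := ram_decomp z.
  have [_ /(_ (b - sec (prk b)))[]] := k_quotient.
  case; first by rewrite rmorphB secK subrr.
  move=> d ed _; exists (prk b), (prA (ram_const s d * t + ram_const s c)).
  rewrite -rmorphM -rmorphD; congr (prA _).
  rewrite -[b in LHS](subrK (sec (prk b))) ed rmorphD rmorphM -ramtM; ring.
rewrite -rmorphXn -rmorphB -rmorphM -rmorphB => /prA_eq0[z].
have -> : t ^+ N = t ^+ N.-1 * t by rewrite -[RHS]exprSr prednK //; lia.
rewrite [RHS]mulrCA => /eqP; rewrite -subr_eq0 -mulrBr => /eqP/(ramtX_regular s_neq0).
have [b [c ->]] := ram_decomp z => e.
have [e1 _] : sec x - sec y - c * s = 0 /\ - b = 0.
  apply: (@ram_eq0 _ s); rewrite -[RHS]e [ram_const s (_ - c * s)]rmorphB.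
  rewrite rmorphM rmorphN -ramtM.
  by ring.
have [_ /(_ (sec x - sec y))[_ ker_k]] := k_quotient.
have /ker_k : principal s (sec x - sec y).
  by exists c; apply/eqP; rewrite -subr_eq0 e1.
by rewrite rmorphB !secK => /eqP; rewrite subr_eq0 => /eqP.
Qed.

End ChainRings.

Theorem theorem7p1
  (O : idomainType) (s : O)
  (O_pid : principal_ideal_ring O)
  (O_local : local_with_maximal_ideal (principal s))
  (O_not_field : ~ is_field O)
  (k : finFieldType) (prk : {rmorphism O -> k})
  (k_quotient : is_quotient prk (principal s))
  (q : nat) (k_card : #|k| = q)
  (k_odd : forall p, p \in [pchar k] -> odd p)
  (l : nat) (l_ge1 : (1 <= l)%N)
  (R : finComNzRingType) (prR : {rmorphism O -> R})
  (R_quotient : is_quotient prR (principal (s ^+ l)))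
  (A : finComUnitRingType) (prA : {rmorphism ramified s -> A})
  (A_quotient : is_quotient prA (principal (ramt s ^+ (2 * l - 1))))
  (iota : {rmorphism R -> A})
  (iota_pr : forall c, iota (prR c) = prA (ramC s c))
  (star : {rmorphism A -> A})
  (star_iota : forall r, star (iota r) = iota r)
  (star_pi : star (prA (ramt s)) = - prA (ramt s))
  (n : nat) (n_ge1 : (1 <= n)%N)
  (V : finLmodType A) (V_free : free_of_rank V (2 * n))
  (h : V -> V -> A) (h_form : nondegenerate_skew_hermitian star h)
  (f : {biscalar (restr iota V)})
  (f_def : forall v w, iota (f v w) = (h v w + star (h v w)) / 2%:R)
  (K : realType) (lam : R -> K[i])
  (lam_char : linear_character lam) (lam_prim : primitive_character lam)
  (d : nat)
  (S : mx_representation K[i] [set: heisenberg f] d)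
  (S_schrodinger : schrodinger lam S)
  (W : mx_representation K[i] [set: Sp f] d)
  (W_weil : weil S W) :
  (* (i, b) : 'I_l * bool is attached to the index i + 1 in {1, .., l} *)
  exists X : 'I_l * bool -> 'M[K[i]]_d,
    [/\ forall j, mxsimple W (X j),
        mxdirect (\sum_j X j) /\ (\sum_j X j :=: 1%:M)%MS,
        forall j1 j2, j1 != j2 -> ~ mx_iso W (X j1) (X j2),
        forall (i : 'I_l) (b : bool), (i.+1 < l)%N ->
          (\rank (X (i, b)))%:R =
            q%:R ^+ ((2 * (l - i.+1) - 1) * n) * (q%:R ^+ (2 * n) - 1) / 2
            :> rat
      & forall i : 'I_l, i.+1 = l ->
          (\rank (X (i, true)))%:R = (q%:R ^+ n + 1) / 2 :> rat /\
          (\rank (X (i, false)))%:R = (q%:R ^+ n - 1) / 2 :> rat].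
Proof.
(* If [s] were 0, the zero ideal would be maximal and [O] a field. *)
have s_neq0 : s != 0.
  apply/eqP=> s0; apply: O_not_field => x nz.
  have [[_ _ max_s] _] := O_local.
  have ideal_x : is_ideal (principal x).
    split; first by exists 0; rewrite mul0r.
      by move=> _ _ [a ->] [b ->]; exists (a + b); rewrite mulrDl.
    by move=> a _ [b ->]; exists (a * b); rewrite mulrA.
  have [y|xs|/(_ 1)[y xy]] := max_s _ ideal_x.
  - by case=> a ->; exists 0; rewrite s0 mulr0 mul0r.
  - have /xs[a ea] : principal x x by exists 1; rewrite mul1r.
    by rewrite ea s0 mulr0 eqxx in nz.
  - by apply/unitrPr; exists y; rewrite mulrC.
have [tau [tau_onto tau_inj]] := residue_lift s_neq0 k_quotient l_ge1 A_quotient.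
have w_nil := uniformizer_nilpotent A_quotient.
have w_div := uniformizer_div s_neq0 A_quotient.
have p_div := base_uniformizer_div s_neq0 R_quotient.
have iota_p := embedding_uniformizer iota_pr.
have iota_inj := embedding_inj s_neq0 l_ge1 R_quotient A_quotient iota_pr.
have A_dec := ramified_decomp A_quotient iota_pr.
have R_local := base_local k_quotient R_quotient.
have two_inv := base_two_inv k_quotient R_quotient k_odd.
have q_gt1 : (1 < q)%N by rewrite -k_card finNzRing_gt1.
have r_gt1 : (1 < q ^ n)%N by rewrite -(exp1n n) ltn_exp2r.
pose w := prA (ramt s); pose U := @level R A iota w l V.
have fvv := trace_form_alternating iota_inj two_inv h_form f_def.
(* The rank [2 * n] of [V] is absorbed by taking [r = q ^ n] in the abstract filtration. *)
have card_U j : (j <= 2 * l - 1)%N -> #|U j| = ((q ^ n) ^ (2 * (2 * l - 1 - j)))%N.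
  move=> le_j; rewrite (card_level _ l_ge1 w_nil w_div tau_onto tau_inj V_free) // k_card.
  by rewrite -expnM mulnCA mulnA.
have perp_U := perp_level l_ge1 iota_p iota_inj A_dec w_nil w_div two_inv
  star_iota star_pi V_free h_form f_def.
have f_nondeg := trace_form_nondeg l_ge1 iota_p iota_inj A_dec w_nil w_div two_inv
  star_iota star_pi V_free h_form f_def.
have two_reg := two_regular two_inv.
have [X [simX sumX isoX rankX rank_last]] := filtered_weil_constituents lam_char
  lam_prim S_schrodinger W_weil fvv f_nondeg two_reg l_ge1 r_gt1
  (level_submodule iota w l V) (level_first iota w_nil V)
  (@level_decr R A iota w l V) perp_U card_U
  (level_orbit l_ge1 iota_p iota_inj A_dec w_nil w_div p_div R_local two_inv
    star_iota star_pi V_free h_form f_def)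
  (level_stable l_ge1 iota_p w_nil w_div two_inv V_free (f := f)).
have two_neq0 : 2 != 0 :> rat by [].
exists X; split=> // [i b lt_il | i eq_il].
  apply: (mulIf two_neq0); rewrite divfK // mulrC -natrM rankX // natrM natrB.
    by rewrite !natrX -!exprM [(n * _)%N]mulnC [(n * 2)%N]mulnC.
  by rewrite expn_gt0 ltnW.
have [e1 e2] := rank_last i eq_il; split; apply: (mulIf two_neq0); rewrite divfK //.
  by rewrite mulrC -natrM e1 natrD natrX.
by rewrite mulrC -natrM e2 natrB ?natrX // ltnW.
Qed.
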